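(* The following statements are equivalent. (i) The Jacobian Conjecture holds in dimension 2, i.e. every $K$-algebra endomorphism $\alpha$ of $K[x,y]$ with $j(\alpha)\in K^*$ is an automorphism. (ii) All Lie subalgebras of $P$ isomorphic to $P_{\leq 2}$ are equivalent under $\mathrm{Aut}_{LA}(P)$. (iii) All Lie subalgebras of $\mathrm{Vec}^{c}(\mathbb{A}^2)$ isomorphic to $\mathfrak{saff}_2$ are conjugate under $\mathrm{Aut}(K[x,y])$. (iv) All Lie subalgebras of $\mathrm{Vec}^{c}(\mathbb{A}^2)$ isomorphic to $\mathfrak{aff}_2$ are conjugate under $\mathrm{Aut}(K[x,y])$.
   Context: $K$ is an algebraically closed field of characteristic zero and $\mathbb{A}^2=K^2$. For a $K$-algebra endomorphism $\alpha$ of $K[x,y]$ with $\alpha(x)=f$, $\alpha(y)=g$, put $j(\alpha)=f_xg_y-f_yg_x$. $P$ is the Poisson algebra: the Lie algebra with underlying vector space $K[x,y]$ and bracket $\{f,g\}=f_xg_y-f_yg_x$. $P_{\leq 2}=\langle 1,x,y,x^2,xy,y^2\rangle\subset P$ is the Lie subalgebra of polynomials of degree $\le 2$ ($\langle\cdots\rangle$ denotes $K$-linear span). $\mathrm{Aut}_{LA}(P)$ is the group of Lie algebra automorphisms of $P$; two Lie subalgebras $Q,Q'\subset P$ are equivalent under $\mathrm{Aut}_{LA}(P)$ if $Q'=\phi(Q)$ for some $\phi\in\mathrm{Aut}_{LA}(P)$. $\mathrm{Vec}(\mathbb{A}^2)=\{p\,\partial_x+q\,\partial_y \mid p,q\in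 K[x,y]\}=\mathrm{Der}_K(K[x,y])$ is the Lie algebra of polynomial vector fields, $\mathrm{div}(p\,\partial_x+q\,\partial_y)=p_x+q_y$, and $\mathrm{Vec}^{c}(\mathbb{A}^2)=\{D\mid \mathrm{div}\,D\in K\}$. $\mathfrak{aff}_2$ is the Lie algebra of the group of affine transformations of $\mathbb{A}^2$, identified with $\langle \partial_x,\partial_y,x\partial_x+y\partial_y,x\partial_x-y\partial_y,x\partial_y,y\partial_x\rangle\subset \mathrm{Vec}^c(\mathbb{A}^2)$; $\mathfrak{saff}_2$ is the Lie algebra of the group of affine transformations of determinant 1, identified with $\langle \partial_x,\partial_y,x\partial_x-y\partial_y,x\partial_y,y\partial_x\rangle$. $\mathrm{Aut}(K[x,y])$ is the group of $K$-algebra automorphisms; it acts on vector fields by $\alpha(D)=\alpha\circ D\circ\alpha^{-1}$, and two Lie subalgebras $L,L'$ are conjugate under $\mathrm{Aut}(K[x,y])$ if $L'=\alpha(L)$ for some $\alpha\in\mathrm{Aut}(K[x,y])$. *)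

(* Defs.v *)
From HB Require Import structures.
From mathcomp Require Import all_boot all_order all_algebra ring.
From mathcomp.multinomials Require Import mpoly.

Set Implicit Arguments.
Unset Strict Implicit.
Unset Printing Implicit Defensive.

Import GRing.Theory.
Local Open Scope ring_scope.

HB.mixin Record isLieAlgebra (K : comNzRingType) L of GRing.Lmodule K L := {
  lie : L -> L -> L;
  lie_linearl : forall a u v w, lie (a *: u + v) w = a *: lie u w + lie v w;
  lie_linearr : forall a u v w, lie w (a *: u + v) = a *: lie w u + lie w v;
  liexx : forall u, lie u u = 0;
  lie_jacobi : forall u v w,
    lie u (lie v w) + lie v (lie w u) + lie w (lie u v) = 0
}.

#[short(type="lieAlgType")]
HB.structure Definition LieAlgebra (K : comNzRingType) :=
  { L of isLieAlgebra K L & GRing.Lmodule K L }.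

(* Subspaces of the (infinite-dimensional) Lie algebras below are Prop-valued
   predicates. *)
Section LieSub.
Variable K : comNzRingType.

Definition lie_subalgebra (L : lieAlgType K) (Q : L -> Prop) : Prop :=
  [/\ Q 0,
      forall (a : K) u v, Q u -> Q v -> Q (a *: u + v) &
      forall u v, Q u -> Q v -> Q (lie u v)].

Definition lie_isomorphism (L L' : lieAlgType K) (Q : L -> Prop)
    (Q' : L' -> Prop) (phi : L -> L') : Prop :=
  [/\ forall (a : K) u v, Q u -> Q v -> phi (a *: u + v) = a *: phi u + phi v,
      forall u v, Q u -> Q v -> phi (lie u v) = lie (phi u) (phi v),
      forall u, Q u -> Q' (phi u),
      forall u v, Q u -> Q v -> phi u = phi v -> u = v &
      forall w, Q' w -> exists2 u, Q u & phi u = w].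

(* Only the values of phi on Q matter. *)
Definition lie_isomorphic (L L' : lieAlgType K) (Q : L -> Prop)
    (Q' : L' -> Prop) : Prop :=
  exists phi : L -> L', lie_isomorphism Q Q' phi.

Definition lie_automorphism (L : lieAlgType K) (phi : {linear L -> L}) : Prop :=
  bijective phi /\ forall u v, phi (lie u v) = lie (phi u) (phi v).

Definition lie_equivalent (L : lieAlgType K) (Q Q' : L -> Prop) : Prop :=
  exists phi : {linear L -> L}, lie_automorphism phi /\
    forall w, Q' w <-> exists2 u, Q u & phi u = w.

Definition lin_span (V : lmodType K) (s : seq V) (v : V) : Prop :=
  exists c : 'I_(size s) -> K, v = \sum_(i < size s) c i *: s`_i.

End LieSub.

Notation polyxy K := {mpoly K[2]}.

Section Plane.
Variable K : comNzRingType.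
Local Notation A := (polyxy K).

Definition xvar : A := 'X_(ord0 : 'I_2).
Definition yvar : A := 'X_(ord_max : 'I_2).
Definition dx (f : A) : A := f^`M(ord0).
Definition dy (f : A) : A := f^`M(ord_max).

Definition jac (f g : A) : A := dx f * dy g - dy f * dx g.

Definition jac_endo (alpha : A -> A) : A := jac (alpha xvar) (alpha yvar).

Lemma dx_lin a f g : dx (a *: f + g) = a *: dx f + dx g.
Proof. by rewrite /dx mderivD mderivZ. Qed.
Lemma dy_lin a f g : dy (a *: f + g) = a *: dy f + dy g.
Proof. by rewrite /dy mderivD mderivZ. Qed.
Lemma dxM f g : dx (f * g) = dx f * g + f * dx g.
Proof. exact: mderivM. Qed.
Lemma dyM f g : dy (f * g) = dy f * g + f * dy g.
Proof. exact: mderivM. Qed.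
Lemma dydx f : dy (dx f) = dx (dy f).
Proof. exact: mderiv_comm. Qed.
Lemma dxN f : dx (- f) = - dx f.
Proof. exact: mderivN. Qed.
Lemma dyN f : dy (- f) = - dy f.
Proof. exact: mderivN. Qed.
Lemma dxD f g : dx (f + g) = dx f + dx g.
Proof. exact: mderivD. Qed.
Lemma dyD f g : dy (f + g) = dy f + dy g.
Proof. exact: mderivD. Qed.
Definition dE := (dxM, dyM, dxN, dyN, dxD, dyD, dydx).

End Plane.

Arguments xvar {K}.
Arguments yvar {K}.

Definition poisson (K : comNzRingType) : Type := {mpoly K[2]}.

HB.instance Definition _ (K : comNzRingType) :=
  GRing.Lmodule.on (poisson K).

Section Poisson.
Variable K : comNzRingType.
Implicit Types (a : K) (f g h : polyxy K).

Let jac_linearl a f g h : jac (a *: f + g) h = a *: jac f h + jac g h.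
Proof. by rewrite /jac dx_lin dy_lin -!mul_mpolyC; ring. Qed.

Let jac_linearr a f g h : jac h (a *: f + g) = a *: jac h f + jac h g.
Proof. by rewrite /jac dx_lin dy_lin -!mul_mpolyC; ring. Qed.

Let jacxx f : jac f f = 0.
Proof. by rewrite /jac; ring. Qed.

Let jac_jacobi f g h : jac f (jac g h) + jac g (jac h f) + jac h (jac f g) = 0.
Proof. by rewrite /jac !dE; ring. Qed.

HB.instance Definition _ := isLieAlgebra.Build K (poisson K)
  jac_linearl jac_linearr jacxx jac_jacobi.

Definition poisson_le2 : poisson K -> Prop :=
  @lin_span K (poisson K)
    [:: 1 : polyxy K; xvar; yvar; xvar ^+ 2; xvar * yvar; yvar ^+ 2].

End Poisson.

(* The pair (p, q) stands for p d/dx + q d/dy. *)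
Definition vecfield (K : comNzRingType) : Type := ({mpoly K[2]} * {mpoly K[2]})%type.

HB.instance Definition _ (K : comNzRingType) :=
  GRing.Lmodule.on (vecfield K).

Section VectorFields.
Variable K : comNzRingType.
Implicit Types (D E F : vecfield K) (f : polyxy K).

Definition vf_app D f : polyxy K := D.1 * dx f + D.2 * dy f.

Definition vf_lie D E : vecfield K :=
  (vf_app D E.1 - vf_app E D.1, vf_app D E.2 - vf_app E D.2).

(* vf_lie is the commutator of derivations. *)
Lemma vf_lieE D E f :
  vf_app (vf_lie D E) f = vf_app D (vf_app E f) - vf_app E (vf_app D f).
Proof. by case: D E => p q [r s]; rewrite /vf_lie /vf_app /= !dE; ring. Qed.

Let vf_linearl (a : K) D E F :
  vf_lie (a *: D + E) F = a *: vf_lie D F + vf_lie E F.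
Proof.
case: D E F => [p q] [r s] [t u].
by congr pair; rewrite /vf_app /= /vf_app /= dx_lin dy_lin -!mul_mpolyC; ring.
Qed.

Let vf_linearr (a : K) D E F :
  vf_lie F (a *: D + E) = a *: vf_lie F D + vf_lie F E.
Proof.
case: D E F => [p q] [r s] [t u].
by congr pair; rewrite /vf_app /= /vf_app /= dx_lin dy_lin -!mul_mpolyC; ring.
Qed.

Let vf_liexx D : vf_lie D D = 0.
Proof. by congr pair; rewrite subrr. Qed.

Let vf_jacobi D E F :
  vf_lie D (vf_lie E F) + vf_lie E (vf_lie F D) + vf_lie F (vf_lie D E) = 0.
Proof.
case: D E F => [p q] [r s] [t u].
by congr pair; rewrite /= /vf_app /= /vf_app /= !dE; ring.
Qed.

HB.instance Definition _ := isLieAlgebra.Build K (vecfield K)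
  vf_linearl vf_linearr vf_liexx vf_jacobi.

Definition divergence D : polyxy K := dx D.1 + dy D.2.

Definition vec_c D : Prop := exists c : K, divergence D = c%:MP.

Definition saff2 : vecfield K -> Prop :=
  @lin_span K (vecfield K)
    [:: (1, 0); (0, 1); (xvar, - yvar); (0, xvar); (yvar, 0)].

Definition aff2 : vecfield K -> Prop :=
  @lin_span K (vecfield K)
    [:: (1, 0); (0, 1); (xvar, yvar); (xvar, - yvar); (0, xvar); (yvar, 0)].

(* L' = alpha(L), where alpha(D) = alpha o D o alpha^-1 as derivations. *)
Definition conjugate (L L' : vecfield K -> Prop) : Prop :=
  exists (alpha : {lrmorphism polyxy K -> polyxy K})
         (alpha_inv : polyxy K -> polyxy K),
  [/\ cancel alpha alpha_inv, cancel alpha_inv alpha &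
      forall E, L' E <->
        exists2 D, L D & vf_app E =1 alpha \o vf_app D \o alpha_inv].

End VectorFields.

(* Main.v *)
Require Import Defs.
From mathcomp Require Import all_boot all_order all_algebra ring.
From mathcomp.multinomials Require Import mpoly.
From Stdlib Require Import Classical ClassicalEpsilon.
Import GRing.Theory.
Local Open Scope ring_scope.

Set Implicit Arguments.
Unset Strict Implicit.
Unset Printing Implicit Defensive.

(** An endomorphism [alpha] of [K[x, y]] whose Jacobian is a nonzero constant
    [c] (call it etale) multiplies Poisson brackets by [c]. So up to a scalar
    it embeds the Poisson algebra into itself, and vector fields can be pushed
    forward along it ([push]), even when [alpha] is not invertible. Such an
    [alpha] is always injective ([etale_inj]); the Jacobian Conjecture is about
    its surjectivity.

    Each of the three kinds of Lie subalgebras is classified by etale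
    endomorphisms: the copies of [poisson_le2] are the images of [poisson_le2]
    ([poisson_le2_image], [le2_image_copy]), and the copies of [saff2] and
    [aff2] in the fields of constant divergence are the push-forwards of
    [saff2] and [aff2] ([model_image], [push_model]). The reason is a rigidity
    of the translations. A copy of [<1, x, y>] in the Poisson algebra gives
    [f], [g] with [{f, g}] a nonzero constant, that is, an etale [alpha], and
    everything else in the copy is determined by its brackets with [f] and [g]
    up to their centraliser, which consists of the constants
    ([jac_centralizer]). For vector fields, the images of [d/dx] and [d/dy] are
    Hamiltonian fields, say of [- g] and [f], with [{f, g}] constant. This
    constant is not zero, because a field of the copy acts on [f] and [g]
    with opposite weights ([jac_hyperbolic]); and what commutes with the
    translations is a translation ([push_centralizer]).

    If the Jacobian Conjecture holds, any two etale endomorphisms differ by an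
    automorphism, so any two copies are equivalent ([jc_poisson], [jc_model]).

    Conversely, let [alpha] be etale and suppose that the copy it defines is
    equivalent to the model. For vector fields, [alpha K[x, y]] is then, after
    an automorphism, a subalgebra stable under [d/dx], [d/dy], [x d/dy] and
    [y d/dx] that contains a nonconstant polynomial. It is therefore everything
    ([saff2_module_vars]), so [alpha] is onto ([model_jc]). For the Poisson
    algebra, the same rigidity shows that a Lie automorphism is a multiple of
    an endomorphism [beta] of [K[x, y]] ([poisson_automorphism_etale]). Since
    it maps [x] and [y] into [alpha K[x, y]], its image, which is everything,
    lies in [alpha K[x, y]] ([poisson_jc]). *)

(** * Linear subspaces and isomorphisms of Lie algebras *)

Section LieSubspaces.
Variable K : comNzRingType.

(** Subspaces are predicates on infinite-dimensional spaces, hence this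
    bundling of the linear part of [lie_subalgebra]. *)
Definition lin_closed (V : lmodType K) (M : V -> Prop) :=
  M 0 /\ forall a u v, M u -> M v -> M (a *: u + v).

Lemma lin_closed_span (V : lmodType K) (s : seq V) : lin_closed (lin_span s).
Proof.
split; first by exists (fun=> 0); rewrite big1 // => i _; rewrite scale0r.
move=> a u v [cu ->] [cv ->]; exists (fun i => a * cu i + cv i).
rewrite scaler_sumr -big_split; apply: eq_bigr => i _ /=.
by rewrite scalerDl scalerA.
Qed.

Lemma lin_span_min (V : lmodType K) (s : seq V) (P : V -> Prop) :
  lin_closed P -> (forall v, v \in s -> P v) -> forall v, lin_span s v -> P v.
Proof.
move=> [P0 Plin] Ps _ [c ->]; apply: (big_ind P) => //.
  by move=> u v Pu Pv; rewrite -[u]scale1r; apply: Plin.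
by move=> i _; rewrite -[_ *: _]addr0; apply: Plin => //; apply/Ps/mem_nth.
Qed.

Lemma lin_closedZ (V : lmodType K) (M : V -> Prop) a u :
  lin_closed M -> M u -> M (a *: u).
Proof. by move=> [M0 Ml] Mu; rewrite -[_ *: _]addr0; apply: Ml. Qed.

Lemma lin_closedD (V : lmodType K) (M : V -> Prop) u v :
  lin_closed M -> M u -> M v -> M (u + v).
Proof. by move=> [M0 Ml] Mu; rewrite -[u]scale1r; apply: Ml. Qed.

(** The inverse isomorphism exists only on [Q'], so its values are chosen
    classically. *)
Lemma lie_isomorphic_sym (L L' : lieAlgType K) (Q : L -> Prop)
    (Q' : L' -> Prop) :
  lin_closed Q -> (forall u v, Q u -> Q v -> Q (lie u v)) ->
  lie_isomorphic Q Q' -> lie_isomorphic Q' Q.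
Proof.
move=> [Q0 Qlin] Qlie [phi [phil phib phiQ phi_inj phi_surj]].
pose psi w := epsilon (inhabits 0) (fun u => Q u /\ phi u = w).
have psiP w : Q' w -> Q (psi w) /\ phi (psi w) = w.
  move=> /phi_surj [u Qu uw].
  exact: (epsilon_spec (inhabits 0) (fun u => Q u /\ phi u = w)
    (ex_intro _ u (conj Qu uw))).
have psiK u : Q u -> psi (phi u) = u.
  move=> Qu; have [Qp e] := psiP _ (phiQ _ Qu); exact: phi_inj.
exists psi; split.
- move=> a u v /psiP [Qu eu] /psiP [Qv ev].
  rewrite -{1}eu -{1}ev -phil // psiK //; exact: Qlin.
- move=> u v /psiP [Qu eu] /psiP [Qv ev].
  rewrite -{1}eu -{1}ev -phib // psiK //; exact: Qlie.
- by move=> u /psiP [].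
- by move=> u v /psiP [_ eu] /psiP [_ ev] e; rewrite -eu -ev e.
- by move=> u Qu; exists (phi u); [exact: phiQ|exact: psiK].
Qed.

Section IsoTheory.
Variables (L L' : lieAlgType K) (Q : L -> Prop) (Q' : L' -> Prop).
Variable psi : L -> L'.
Hypotheses (iso : lie_isomorphism Q Q' psi) (Ql : lin_closed Q).

Lemma lie_isomorphism0 : psi 0 = 0.
Proof.
case: iso => psil _ _ _ _; have := psil (-1) 0 0 Ql.1 Ql.1.
by rewrite scaler0 addr0 scaleN1r addNr.
Qed.

Lemma lie_isomorphismZ a u : Q u -> psi (a *: u) = a *: psi u.
Proof.
case: iso => psil _ _ _ _ Qu; have := psil a u 0 Qu Ql.1.
by rewrite lie_isomorphism0 !addr0.
Qed.
End IsoTheory.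

End LieSubspaces.

(** * Polynomials in two variables *)

Section Plane.
Variable K : closedFieldType.
Hypothesis charK0 : [pchar K] =i pred0.
Local Notation A := {mpoly K[2]}.
Implicit Types (a b c : K) (f g h p q u v w : A) (D E N : vecfield K).

Lemma natr_neq0 n : n.+1%:R != 0 :> K.
Proof. by rewrite (iffLR (pcharf0P _)). Qed.

Lemma dxx : dx xvar = 1 :> A.
Proof.
rewrite /dx /xvar mderivX mnm1E eqxx scale1r -{1}[U_(_)%MM]add0m.
by rewrite addmK mpolyX0.
Qed.

Lemma dxy : dx yvar = 0 :> A.
Proof. by rewrite /dx /yvar mderivX mnm1E scale0r. Qed.

Lemma dyx : dy xvar = 0 :> A.
Proof. by rewrite /dy /xvar mderivX mnm1E scale0r. Qed.

Lemma dyy : dy yvar = 1 :> A.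
Proof.
rewrite /dy /yvar mderivX mnm1E eqxx scale1r -{1}[U_(_)%MM]add0m.
by rewrite addmK mpolyX0.
Qed.

Lemma dxC c : dx c%:MP = 0 :> A.
Proof. exact: mderivC. Qed.

Lemma dyC c : dy c%:MP = 0 :> A.
Proof. exact: mderivC. Qed.

Lemma dxZ c u : dx (c *: u) = c *: dx u.
Proof. exact: mderivZ. Qed.

Lemma dyZ c u : dy (c *: u) = c *: dy u.
Proof. exact: mderivZ. Qed.

Lemma dxB u v : dx (u - v) = dx u - dx v.
Proof. exact: mderivB. Qed.

Lemma dyB u v : dy (u - v) = dy u - dy v.
Proof. exact: mderivB. Qed.

Lemma dx1 : dx 1 = 0 :> A.
Proof. by rewrite -mpolyC1 dxC. Qed.

Lemma dy1 : dy 1 = 0 :> A.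
Proof. by rewrite -mpolyC1 dyC. Qed.

Lemma dx0 : dx 0 = 0 :> A.
Proof. exact: mderiv0. Qed.

Lemma dy0 : dy 0 = 0 :> A.
Proof. exact: mderiv0. Qed.

Definition dvarE := (dxx, dxy, dyx, dyy, dxC, dyC, dx1, dy1, dx0, dy0).

Lemma monomial_ind (P : A -> Prop) :
  (forall a u v, P u -> P v -> P (a *: u + v)) ->
  P 0 -> (forall i j, P (xvar ^+ i * yvar ^+ j)) -> forall u, P u.
Proof.
move=> Plin P0 Pmon; apply: mpolyind => // c m p _ _ Pp.
apply: Plin => //; rewrite mpolyXE_id big_ord_recr big_ord1 /=.
suff -> : widen_ord (leqnSn 1) ord0 = ord0 :> 'I_2 by [].
exact: val_inj.
Qed.

Lemma subalgebra_full (P : A -> Prop) :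
  (forall a u v, P u -> P v -> P (a *: u + v)) ->
  (forall u v, P u -> P v -> P (u * v)) ->
  P 1 -> P xvar -> P yvar -> forall u, P u.
Proof.
move=> Plin Pmul P1 Px Py; apply: monomial_ind => //.
  by rewrite -(addNr 1) -scaleN1r; apply: Plin.
have Pexp u n : P u -> P (u ^+ n).
  by move=> Pu; elim: n => [//|n IH]; rewrite exprS; apply: Pmul.
by move=> i j; apply: Pmul; apply: Pexp.
Qed.

Lemma lrmorph_ext (alpha beta : {lrmorphism A -> A}) :
  alpha xvar = beta xvar -> alpha yvar = beta yvar -> alpha =1 beta.
Proof.
move=> ex ey; apply: subalgebra_full => //.
- by move=> a u v eu ev; rewrite !linearD !linearZ /= eu ev.
- by move=> u v eu ev; rewrite !rmorphM /= eu ev.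
- by rewrite !rmorph1.
Qed.

Definition endo f g : {lrmorphism A -> A} := comp_mpoly [tuple f; g].

Lemma endo_x f g : endo f g xvar = f.
Proof. exact: comp_mpolyXU. Qed.

Lemma endo_y f g : endo f g yvar = g.
Proof. exact: comp_mpolyXU. Qed.

Lemma lrmorphC (alpha : {lrmorphism A -> A}) c : alpha c%:MP = c%:MP.
Proof. by rewrite -[c%:MP]mulr1 mul_mpolyC linearZ rmorph1. Qed.

Lemma mcoeff_mderiv_eq0 i u (m : 'X_{1..2}) :
  mderiv i u = 0 -> m i != 0%N -> u@_m = 0.
Proof.
move=> ui mi; have := congr1 (mcoeff (m - U_(i))) ui.
rewrite mcoeff_deriv mcoeff0.
rewrite submK; last by rewrite lep1mP.
rewrite -mulr_natr => /eqP; rewrite mulf_eq0 (negPf (natr_neq0 _)) orbF.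
by move/eqP.
Qed.

Lemma constant_dxdy u : dx u = 0 -> dy u = 0 -> exists c, u = c%:MP.
Proof.
move=> ux uy; exists u@_0; apply/mpolyP => m; rewrite mcoeffC.
have [->|m0] := eqVneq m 0%MM; first by rewrite mulr1.
rewrite mulr0.
have [i mi] : exists i, m i != 0%N.
  apply/existsP; apply: contraR m0; rewrite negb_exists => /forallP m0.
  by apply/eqP/mnmP => i; rewrite mnm0E; move/negPn/eqP: (m0 i).
have ui : mderiv i u = 0.
  have [->|->] : i = ord0 \/ i = ord_max.
    by case: i {mi} => [[|[|]]] // ?; [left|right]; exact: val_inj.
  - exact: ux.
  - exact: uy.
exact: (mcoeff_mderiv_eq0 ui).
Qed.

Lemma msize_mderiv i u n : (msize u <= n.+1)%N -> (msize (mderiv i u) <= n)%N.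
Proof.
move=> un; rewrite msizeE; apply/bigmax_leqP_seq => m mu _.
rewrite -ltnS; apply: leq_trans un.
have /msize_mdeg_lt : (m + U_(i))%MM \in msupp u.
  rewrite mcoeff_msupp; apply: contraTneq mu => um.
  by rewrite mcoeff_msupp mcoeff_deriv um mul0rn eqxx.
by rewrite mdegD mdeg1 addn1.
Qed.

Lemma derivative_ind (P : A -> Prop) :
  (forall c, P c%:MP) -> (forall u, P (dx u) -> P (dy u) -> P u) ->
  forall u, P u.
Proof.
move=> PC Pd u; have [n] := ubnP (msize u).
elim: n u => // n IHn u; rewrite ltnS => un.
have [u1|u1] := leqP (msize u) 1.
  by rewrite (msize1_polyC u1); apply: PC.
case: n => [|n] in un IHn *; first by have := leq_trans u1 un.
apply: Pd; apply: IHn; rewrite ltnS; exact: msize_mderiv.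
Qed.

(** The primitive obtained by integrating monomial by monomial. This
    integration commutes with differentiating along the other variable, hence
    the second clause. *)
Lemma antiderivative (i j : 'I_2) u : exists w,
  mderiv j w = u /\ (i != j -> mderiv i u = 0 -> mderiv i w = 0).
Proof.
exists (\sum_(m <- msupp u) (u@_m / (m j).+1%:R) *: 'X_[m + U_(j)]); split.
  rewrite linear_sum [RHS]mpolyE; apply: eq_bigr => m _.
  rewrite linearZ /= mderivX addmK mnmDE mnm1E eqxx addn1 scalerA.
  by rewrite divfK ?natr_neq0.
move=> ij ui; rewrite linear_sum big1_seq //= => m mu.
rewrite linearZ /= mderivX mnmDE mnm1E eq_sym (negPf ij) addn0 scalerA.
have [->|mi] := eqVneq (m i) 0%N; first by rewrite mulr0 scale0r.
by rewrite (mcoeff_mderiv_eq0 ui) // !mul0r scale0r.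
Qed.

(** Polynomial Poincare lemma in the plane: first integrate [p] along [x],
    then correct by a primitive along [y] of what is missing in [q], which does
    not depend on [x]. *)
Lemma closed_form_exact p q : dy p = dx q -> exists h, dx h = p /\ dy h = q.
Proof.
move=> pq; have [u [up _]] := antiderivative ord_max ord0 p.
have [w [wq wx]] := antiderivative ord0 ord_max (q - dy u).
exists (u + w); rewrite dxD dyD; split.
  rewrite [dx w]wx // ?addr0 //.
  by rewrite -[LHS]/(dx _) dxB -pq -dydx [dx u]up subrr.
by rewrite [dy w]wq addrC subrK.
Qed.

(** * The Poisson bracket and etale endomorphisms *)

Lemma jacZl c u v : jac (c *: u) v = c *: jac u v.
Proof. by rewrite /jac !dxZ !dyZ -!mul_mpolyC; ring. Qed.

Lemma jacZr c u v : jac u (c *: v) = c *: jac u v.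
Proof. by rewrite /jac !dxZ !dyZ -!mul_mpolyC; ring. Qed.

Lemma jacBl u v w : jac (u - v) w = jac u w - jac v w.
Proof. by rewrite /jac !dE; ring. Qed.

Lemma jacC u v : jac u v = - jac v u.
Proof. by rewrite /jac; ring. Qed.

Lemma jac_xl u : jac xvar u = dy u.
Proof. by rewrite /jac dxx dyx; ring. Qed.

Lemma jac_yl u : jac yvar u = - dx u.
Proof. by rewrite /jac dxy dyy; ring. Qed.

Lemma jac_xr u : jac u xvar = - dy u.
Proof. by rewrite jacC jac_xl. Qed.

Lemma jac_yr u : jac u yvar = dx u.
Proof. by rewrite jacC jac_yl opprK. Qed.

(** The gradient of [u] would be proportional to those of [f] and [g], which
    are independent over [K(x, y)]; so it is zero. *)
Lemma jac_centralizer f g u :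
  jac f g != 0 -> jac u f = 0 -> jac u g = 0 -> exists c, u = c%:MP.
Proof.
move=> fg0 uf ug; apply: constant_dxdy.
- apply: (mulIf fg0); rewrite mul0r.
  transitivity (dx f * jac u g - dx g * jac u f); first by rewrite /jac; ring.
  by rewrite uf ug; ring.
- apply: (mulIf fg0); rewrite mul0r.
  transitivity (dy f * jac u g - dy g * jac u f); first by rewrite /jac; ring.
  by rewrite uf ug; ring.
Qed.

Lemma mderiv_lrmorph (alpha : {lrmorphism A -> A}) (i : 'I_2) u :
  mderiv i (alpha u) = alpha (dx u) * mderiv i (alpha xvar)
                       + alpha (dy u) * mderiv i (alpha yvar).
Proof.
elim/subalgebra_full: u => [a u v eu ev|u v eu ev|||].
- rewrite linearD linearZ /= mderivD mderivZ eu ev !dx_lin !dy_lin.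
  by rewrite !linearD !linearZ /= -!mul_mpolyC; ring.
- by rewrite rmorphM /= mderivM eu ev dxM dyM !linearD /= !rmorphM /=; ring.
- by rewrite rmorph1 !dvarE -mpolyC1 mderivC linear0; ring.
- by rewrite !dvarE rmorph1 linear0; ring.
- by rewrite !dvarE rmorph1 linear0; ring.
Qed.

Lemma dx_lrmorph (alpha : {lrmorphism A -> A}) u :
  dx (alpha u) = alpha (dx u) * dx (alpha xvar)
                 + alpha (dy u) * dx (alpha yvar).
Proof. exact: mderiv_lrmorph. Qed.

Lemma dy_lrmorph (alpha : {lrmorphism A -> A}) u :
  dy (alpha u) = alpha (dx u) * dy (alpha xvar)
                 + alpha (dy u) * dy (alpha yvar).
Proof. exact: mderiv_lrmorph. Qed.

Lemma jac_lrmorph (alpha : {lrmorphism A -> A}) u v :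
  jac (alpha u) (alpha v) = alpha (jac u v) * jac_endo alpha.
Proof.
rewrite /jac_endo /jac (dx_lrmorph _ u) (dx_lrmorph _ v) (dy_lrmorph _ u).
by rewrite (dy_lrmorph _ v) linearB /= !rmorphM /=; ring.
Qed.

(** Over a field of characteristic zero, a nonzero constant Jacobian says that
    the polynomial map of the plane given by [alpha] is etale. *)
Definition etale c (alpha : {lrmorphism A -> A}) :=
  c != 0 /\ jac_endo alpha = c%:MP.

Section EtaleTheory.
Variables (alpha : {lrmorphism A -> A}) (c : K).
Hypothesis et : etale c alpha.

Lemma etale_jac u v : jac (alpha u) (alpha v) = c *: alpha (jac u v).
Proof. by rewrite jac_lrmorph et.2 mulrC mul_mpolyC. Qed.

(** A polynomial relation between [alpha x] and [alpha y] differentiates to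
    relations of smaller degree, because [{alpha u, alpha v}] is a nonzero
    multiple of [alpha {u, v}]. *)
Lemma etale_inj : injective alpha.
Proof.
suff a0 u : alpha u = 0 -> u = 0.
  by move=> u v e; apply/subr0_eq/a0; rewrite linearB /= e subrr.
elim/derivative_ind: u => [a|u IHx IHy u0]; first by rewrite lrmorphC.
have d0 v : alpha (jac u v) = 0.
  apply/eqP; rewrite -(inj_eq (scalerI et.1)) -etale_jac u0 scaler0.
  by rewrite /jac /dx /dy !mderiv0; apply/eqP; ring.
have ux : dx u = 0 by apply: IHx; rewrite -jac_yr.
have uy : dy u = 0.
  by apply: IHy; rewrite -[dy u]opprK -jac_xr linearN /= d0 oppr0.
have [a ua] := constant_dxdy ux uy.
by move: u0; rewrite ua lrmorphC.
Qed.

Lemma etale_gens_jac : jac (alpha xvar) (alpha yvar) != 0.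
Proof. by rewrite -/(jac_endo alpha) et.2 mpolyC_eq0 et.1. Qed.

(** The field [alpha_* D] for an etale [alpha] that need not be
    invertible. Dividing by the Jacobian [c] is what Cramer's rule gives for the
    field that sends [alpha u] to [alpha (D u)], see [push_app]. *)
Definition push D : vecfield K :=
  (c^-1 *: (alpha D.1 * dy (alpha yvar) - alpha D.2 * dy (alpha xvar)),
   c^-1 *: (alpha D.2 * dx (alpha xvar) - alpha D.1 * dx (alpha yvar))).

Lemma vf_app_lrmorph D u :
  vf_app D (alpha u) = alpha (dx u) * vf_app D (alpha xvar)
                       + alpha (dy u) * vf_app D (alpha yvar).
Proof. by rewrite /vf_app (dx_lrmorph _ u) (dy_lrmorph _ u); ring. Qed.

Lemma push_app D u : vf_app (push D) (alpha u) = alpha (vf_app D u).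
Proof.
have cj : c^-1 *: jac (alpha xvar) (alpha yvar) = 1.
  by rewrite -/(jac_endo _) et.2 -mul_mpolyC -mpolyCM mulVf ?et.1 ?mpolyC1.
rewrite vf_app_lrmorph /vf_app linearD /= !rmorphM /=.
rewrite -[RHS]mulr1 -cj /jac /push /= -!mul_mpolyC; ring.
Qed.

Lemma vecfield_etale_ext D E :
  vf_app D (alpha xvar) = vf_app E (alpha xvar) ->
  vf_app D (alpha yvar) = vf_app E (alpha yvar) -> D = E.
Proof.
case: D E => [p q] [p' q']; rewrite /vf_app /= => ex ey.
have diff0 u : p * dx u + q * dy u = p' * dx u + q' * dy u ->
    (p - p') * dx u + (q - q') * dy u = 0.
  by move=> e; rewrite !mulrBl addrACA -opprD e subrr.
have jx : (p - p') * jac (alpha xvar) (alpha yvar) =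
    dy (alpha yvar) * ((p - p') * dx (alpha xvar) + (q - q') * dy (alpha xvar))
  - dy (alpha xvar) * ((p - p') * dx (alpha yvar) + (q - q') * dy (alpha yvar)).
  by rewrite /jac; ring.
have jy : (q - q') * jac (alpha xvar) (alpha yvar) =
    dx (alpha xvar) * ((p - p') * dx (alpha yvar) + (q - q') * dy (alpha yvar))
  - dx (alpha yvar) * ((p - p') * dx (alpha xvar) + (q - q') * dy (alpha xvar)).
  by rewrite /jac; ring.
by congr pair; apply/subr0_eq/(mulIf etale_gens_jac);
   rewrite ?jx ?jy !diff0 // !mulr0 subrr mul0r.
Qed.

End EtaleTheory.

(** * Hamiltonian fields and push-forwards *)

Lemma vf_app_x D : vf_app D xvar = D.1.
Proof. by rewrite /vf_app dxx dyx; ring. Qed.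

Lemma vf_app_y D : vf_app D yvar = D.2.
Proof. by rewrite /vf_app dxy dyy; ring. Qed.

Lemma vf_app_lin a D E u :
  vf_app (a *: D + E) u = a *: vf_app D u + vf_app E u.
Proof. by rewrite /vf_app /= -!mul_mpolyC; ring. Qed.

Lemma vf_app0 u : vf_app (0 : vecfield K) u = 0.
Proof. by rewrite /vf_app /= !mul0r addr0. Qed.

Lemma vf_appZ a D u : vf_app (a *: D) u = a *: vf_app D u.
Proof. by rewrite -[a *: D]addr0 vf_app_lin vf_app0 addr0. Qed.

Lemma vf_app_lie D E u :
  vf_app (lie D E) u = vf_app D (vf_app E u) - vf_app E (vf_app D u).
Proof. exact: vf_lieE. Qed.

Lemma vf_appC D c : vf_app D c%:MP = 0.
Proof. by rewrite /vf_app !dvarE; ring. Qed.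

Lemma divergence_lie D E :
  divergence (lie D E) = vf_app D (divergence E) - vf_app E (divergence D).
Proof.
by case: D E => p q [r s]; rewrite /divergence /= /vf_app /= !dE; ring.
Qed.

(** The Hamiltonian field of [h], which acts as [{h, -}]. *)
Definition ham h : vecfield K := (- dy h, dx h).

Lemma ham_app h u : vf_app (ham h) u = jac h u.
Proof. by rewrite /vf_app /jac /=; ring. Qed.

Lemma ham_x : ham xvar = (0, 1).
Proof. by rewrite /ham !dvarE oppr0. Qed.

Lemma ham_y : ham (- yvar) = (1, 0).
Proof. by rewrite /ham dyN dxN !dvarE opprK oppr0. Qed.

Lemma lie_ham f g : lie (ham f) (ham g) = ham (jac f g).
Proof. by congr pair; rewrite !ham_app /jac !dE; ring. Qed.

Lemma hamB f g : ham (f - g) = ham f - ham g.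
Proof. by congr pair; rewrite ?dxB ?dyB //= opprB opprK addrC. Qed.

Lemma hamZ a f : ham (a *: f) = a *: ham f.
Proof. by congr pair; rewrite ?dxZ ?dyZ //= scalerN. Qed.

Lemma ham_eq0 f : ham f = 0 -> exists c, f = c%:MP.
Proof.
move=> e; apply: constant_dxdy; first exact: (congr1 snd e).
by apply: oppr_inj; rewrite oppr0; exact: (congr1 fst e).
Qed.

Lemma divergence0_ham D : divergence D = 0 -> exists h, D = ham h.
Proof.
case: D => p q /eqP; rewrite /divergence /= addr_eq0 => /eqP pq.
have [|h [hx hy]] := closed_form_exact (p := q) (q := - p).
  by rewrite dxN pq opprK.
by exists h; rewrite /ham hx hy opprK.
Qed.

Section EtalePush.
Variables (alpha : {lrmorphism A -> A}) (c : K).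
Hypothesis et : etale c alpha.
Local Notation push := (push alpha c).
Local Notation push_app := (push_app et).

Lemma push_ext D E :
  (forall u, vf_app D (alpha u) = vf_app E (alpha u)) -> D = E.
Proof. by move=> e; apply: (vecfield_etale_ext et); apply: e. Qed.

Lemma push_lin a D E : push (a *: D + E) = a *: push D + push E.
Proof.
apply: push_ext => u.
by rewrite vf_app_lin !push_app vf_app_lin linearD linearZ.
Qed.

Lemma pushZ a D : push (a *: D) = a *: push D.
Proof. by apply: push_ext => u; rewrite vf_appZ !push_app vf_appZ linearZ. Qed.

Lemma pushD D E : push (D + E) = push D + push E.
Proof. by rewrite -[D]scale1r push_lin !scale1r. Qed.

Lemma push_lie D E : push (lie D E) = lie (push D) (push E).
Proof.
by apply: push_ext => u; rewrite !vf_app_lie !push_app vf_app_lie linearB.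
Qed.

(** Push-forward of Hamiltonian fields divides the Hamiltonian by the
    Jacobian, since [alpha] itself multiplies brackets by it. *)
Lemma push_ham h : push (ham h) = c^-1 *: ham (alpha h).
Proof.
apply: push_ext => u; rewrite push_app vf_appZ !ham_app (etale_jac et).
by rewrite scalerA mulVf ?et.1 // scale1r.
Qed.

Lemma push_inj : injective push.
Proof.
move=> D E e.
have app u : vf_app D u = vf_app E u.
  by apply: (etale_inj et); rewrite -!push_app e.
by case: D E {e} app => [p q] [r s] app; congr pair;
  [have := app xvar; rewrite !vf_app_x|have := app yvar; rewrite !vf_app_y].
Qed.

Lemma divergence_push D : divergence (push D) = alpha (divergence D).
Proof.
case: D => p q.
have -> : divergence (push (p, q))
  = c^-1 *: (jac (alpha p) (alpha yvar) + jac (alpha xvar) (alpha q)).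
  by rewrite /divergence /= dxZ dyZ -!mul_mpolyC /jac !dE; ring.
rewrite !(etale_jac et) -scalerDr scalerA mulVf ?et.1 // scale1r.
by rewrite jac_yr jac_xl -linearD.
Qed.

(** Up to scalars, the pushed constant fields are the Hamiltonian fields of
    [alpha x] and [- alpha y], and they map [alpha x] and [alpha y] to
    constants. If [N] commutes with them, they kill [N (alpha x)] and
    [N (alpha y)], which are therefore constants by [jac_centralizer]; and
    these two values determine [N]. *)
Lemma push_centralizer N :
  lie N (push (1, 0)) = 0 -> lie N (push (0, 1)) = 0 ->
  exists a b, N = push (a%:MP, b%:MP).
Proof.
move=> Nx Ny.
have cst u r s : vf_app (push (1, 0)) (alpha u) = r%:MP ->
    vf_app (push (0, 1)) (alpha u) = s%:MP ->
    exists a, vf_app N (alpha u) = a%:MP.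
  move=> ur us; apply: (jac_centralizer (etale_gens_jac et)).
  - have := congr1 (fun D => vf_app D (alpha u)) Ny.
    rewrite vf_app_lie us vf_appC sub0r vf_app0 -ham_x push_ham vf_appZ.
    rewrite ham_app => /eqP.
    rewrite oppr_eq0 scaler_eq0 invr_eq0 (negPf et.1) /= => /eqP e.
    by rewrite jacC e oppr0.
  - have := congr1 (fun D => vf_app D (alpha u)) Nx.
    rewrite vf_app_lie ur vf_appC sub0r vf_app0 -ham_y push_ham vf_appZ.
    rewrite ham_app => /eqP.
    rewrite oppr_eq0 scaler_eq0 invr_eq0 (negPf et.1) /= => /eqP e.
    rewrite linearN /= in e.
    by rewrite -[alpha yvar]opprK jacC -[- - _]scaleN1r jacZl e scaler0 oppr0.
have [||a Na] := cst xvar 1 0.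
  by rewrite push_app vf_app_x rmorph1 mpolyC1.
  by rewrite push_app vf_app_x linear0 mpolyC0.
have [||b Nb] := cst yvar 0 1.
  by rewrite push_app vf_app_y linear0 mpolyC0.
  by rewrite push_app vf_app_y rmorph1 mpolyC1.
exists a, b; apply: (vecfield_etale_ext et).
- by rewrite Na push_app vf_app_x lrmorphC.
- by rewrite Nb push_app vf_app_y lrmorphC.
Qed.

End EtalePush.

(** * The model algebras *)

Definition affine u := exists a b e, u = a%:MP + b *: xvar + e *: yvar.

Lemma affineP u :
  affine u <-> (exists b, dx u = b%:MP) /\ (exists e, dy u = e%:MP).
Proof.
split=> [[a [b [e ->]]]|[[b ub] [e ue]]].
  split; [exists b|exists e]; rewrite ?dxD ?dyD ?dxZ ?dyZ !dvarE;
  by rewrite scaler0 ?addr0 add0r -mul_mpolyC mulr1.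
have [||a ua] := constant_dxdy (u := u - b *: xvar - e *: yvar).
- rewrite !dxB !dxZ !dvarE ub -!mul_mpolyC; ring.
- rewrite !dyB !dyZ !dvarE ue -!mul_mpolyC; ring.
by exists a, b, e; rewrite -ua -!mul_mpolyC; ring.
Qed.

Lemma affine_lin : @lin_closed K A affine.
Proof.
split; first by exists 0, 0, 0; rewrite mpolyC0 !scale0r !addr0.
move=> a u v [a1 [b1 [e1 ->]]] [a2 [b2 [e2 ->]]].
exists (a * a1 + a2), (a * b1 + b2), (a * e1 + e2).
by rewrite -!mul_mpolyC !mpolyCD !mpolyCM; ring.
Qed.

Lemma affineC c : affine c%:MP.
Proof. by exists c, 0, 0; rewrite !scale0r !addr0. Qed.

Lemma affine_x : affine xvar.
Proof. by exists 0, 1, 0; rewrite scale0r scale1r mpolyC0 add0r addr0. Qed.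

Lemma affine_y : affine yvar.
Proof. by exists 0, 0, 1; rewrite scale0r scale1r mpolyC0 !add0r. Qed.

Lemma affine0 : affine 0.
Proof. exact: affine_lin.1. Qed.

Lemma affineN u : affine u -> affine (- u).
Proof. by rewrite -scaleN1r; apply: lin_closedZ affine_lin. Qed.

Hint Resolve affine_x affine_y affine0 affineC affineN : core.

Lemma affine1 : affine 1.
Proof. by rewrite -mpolyC1. Qed.

Hint Resolve affine1 : core.

Lemma half_add c : c = 2%:R^-1 * c + 2%:R^-1 * c.
Proof.
rewrite -mulr2n -mulrnAl -[_^-1 *+ 2]mulr_natr mulVf ?natr_neq0 //.
by rewrite mul1r.
Qed.

Lemma aff2P D : aff2 D <-> affine D.1 /\ affine D.2.
Proof.
split.
  apply: (lin_span_min (P := fun D : vecfield K => affine D.1 /\ affine D.2)).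
    split; first by split; exact: affine0.
    by move=> a [p q] [r s] [Ap Aq] [Ar As]; split; apply: affine_lin.2.
  move=> E; rewrite !inE.
  by do ![case/orP]; move=> /eqP -> /=; split; auto.
case: D => _ _ /= [[a1 [b1 [e1 ->]]] [a2 [b2 [e2 ->]]]].
pose r := 2%:R^-1 * (b1 + e2); pose t := 2%:R^-1 * (b1 - e2).
exists (nth 0 [:: a1; a2; r; t; b2; e1] \o val).
rewrite !big_ord_recl big_ord0 /=.
congr pair; rewrite /= -!mul_mpolyC ?mulr0 ?mulr1 /r /t.
- by rewrite {1}(half_add b1) !mpolyCD !mpolyCM !mpolyCD mpolyCN; ring.
- by rewrite {1}(half_add e2) !mpolyCD !mpolyCM !mpolyCD mpolyCN; ring.
Qed.

Lemma saff2P D : saff2 D <-> aff2 D /\ divergence D = 0.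
Proof.
split.
  move=> sD; rewrite aff2P and_assoc.
  pose P D := affine D.1 /\ affine D.2 /\ divergence D = 0.
  apply: (lin_span_min (P := P) _ _ sD).
    split; first by do 2![split=> //]; rewrite /divergence dx0 dy0 addr0.
    move=> a [p q] [r s] [Ap [Aq dpq]] [Ar [As drs]].
    split; [exact: affine_lin.2|split; [exact: affine_lin.2|]].
    move: dpq drs; rewrite /divergence /= dx_lin dy_lin => dpq drs.
    by rewrite addrACA -scalerDr dpq drs scaler0 addr0.
  move=> E; rewrite !inE /P /divergence.
  by do ![case/orP]; move=> /eqP -> /=; split; auto; split; auto;
    rewrite ?dyN !dvarE ?subrr ?addr0.
rewrite aff2P; case: D => _ _ /= [[[a1 [b1 [e1 ->]]] [a2 [b2 [e2 ->]]]]].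
rewrite /divergence /= !dxD !dyD !dxZ !dyZ !dvarE !scaler0 !addr0 !add0r.
rewrite -scalerDl -mul_mpolyC mulr1 => /eqP.
rewrite mpolyC_eq0 addr_eq0 => /eqP ->.
exists (nth 0 [:: a1; a2; - e2; b2; e1] \o val).
rewrite !big_ord_recl big_ord0 /=.
by congr pair; rewrite /= -!mul_mpolyC ?mulr0 ?mulr1 mpolyCN; ring.
Qed.

(** Being of degree at most 2 is a condition on the gradient, which makes
    stability under the bracket a statement about affine polynomials. *)
Lemma poisson_le2P u : poisson_le2 u <-> affine (dx u) /\ affine (dy u).
Proof.
split.
  pose P (u : poisson K) := affine (dx u) /\ affine (dy u).
  apply: (lin_span_min (P := P)).
    split; first by rewrite /P dx0 dy0.
    move=> a v w [vx vy] [wx wy]; rewrite /P dx_lin dy_lin.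
    by split; apply: affine_lin.2.
  move=> v; rewrite !inE /P.
  do ![case/orP]; move=> /eqP ->; rewrite ?expr2 ?dxM ?dyM !dvarE;
    rewrite ?mulr1 ?mul1r ?mulr0 ?mul0r ?addr0 ?add0r;
    by split; auto; apply: (lin_closedD affine_lin).
move=> [[a1 [b1 [e1 ux]]] [a2 [b2 [e2 uy]]]].
have eb : e1 = b2.
  have := congr1 (@dy _) ux.
  rewrite dydx uy !dxD !dyD !dxZ !dyZ !dvarE !scaler0 !addr0 !add0r.
  rewrite -!mul_mpolyC !mulr1 => /eqP.
  by rewrite mpolyC_eq => /eqP.
pose r := a1 *: xvar + a2 *: yvar + (2%:R^-1 * b1) *: xvar ^+ 2
          + b2 *: (xvar * yvar) + (2%:R^-1 * e2) *: yvar ^+ 2 : A.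
have [||c uc] := constant_dxdy (u := u - r).
- rewrite dxB ux /r !dxD !dxZ !expr2 !dxM !dvarE eb {1}(half_add b1).
  by rewrite -!mul_mpolyC !mpolyCD !mpolyCM; ring.
- rewrite dyB uy /r !dyD !dyZ !expr2 !dyM !dvarE {1}(half_add e2) -!mul_mpolyC.
  by rewrite !mpolyCD !mpolyCM; ring.
exists (nth 0 [:: c; a1; a2; 2%:R^-1 * b1; b2; 2%:R^-1 * e2] \o val).
rewrite !big_ord_recl big_ord0 /= -[u](subrK r) uc /r -!mul_mpolyC; ring.
Qed.

Lemma poisson_le2_subalg : lie_subalgebra (@poisson_le2 K).
Proof.
have [M0 Ml] : lin_closed (@poisson_le2 K) by exact: lin_closed_span.
split=> // u v /poisson_le2P [ux uy] /poisson_le2P [vx vy]; apply/poisson_le2P.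
have aff f w : affine f -> affine (dx w) -> affine (dy w) -> affine (jac f w).
  move=> /affineP[[b fx] [e fy]] wx wy.
  rewrite /jac fx fy !mul_mpolyC -scaleNr addrC.
  by apply: affine_lin.2 => //; apply: (lin_closedZ _ affine_lin).
split.
- have -> : dx (lie u v) = jac (dx u) v - jac (dx v) u.
    by rewrite /lie /= /jac !dE; ring.
  by apply: (lin_closedD affine_lin); [|apply: affineN]; apply: aff.
- have -> : dy (lie u v) = jac (dy u) v - jac (dy v) u.
    by rewrite /lie /= /jac !dE; ring.
  by apply: (lin_closedD affine_lin); [|apply: affineN]; apply: aff.
Qed.

Lemma aff2_lie D E : aff2 D -> aff2 E -> aff2 (lie D E).
Proof.
move=> /aff2P [D1 D2] /aff2P [E1 E2]; apply/aff2P.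
have aff (F : vecfield K) w :
    affine F.1 -> affine F.2 -> affine w -> affine (vf_app F w).
  move=> F1 F2 /affineP[[b wx] [e wy]].
  rewrite /vf_app wx wy ![_ * _%:MP]mulrC !mul_mpolyC.
  by apply: affine_lin.2 => //; apply: (lin_closedZ _ affine_lin).
by split; apply: (lin_closedD affine_lin); do ?[apply: affineN]; apply: aff.
Qed.

Lemma aff2_vec_c D : aff2 D -> vec_c D.
Proof.
move=> /aff2P [/affineP[[b Db] _] /affineP[_ [e De]]].
by exists (b + e); rewrite /divergence Db De mpolyCD.
Qed.

Lemma aff2_subalg : lie_subalgebra (@aff2 K).
Proof.
have [M0 Ml] : lin_closed (@aff2 K) by exact: lin_closed_span.
by split=> //; exact: aff2_lie.
Qed.

Lemma saff2_subalg : lie_subalgebra (@saff2 K).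
Proof.
have [M0 Ml] : lin_closed (@saff2 K) by exact: lin_closed_span.
split=> // D E /saff2P [D1 D2] /saff2P [E1 E2]; apply/saff2P.
split; first exact: aff2_lie.
by rewrite divergence_lie D2 E2 -mpolyC0 !vf_appC subrr.
Qed.

(** * Copies of the algebra of polynomials of degree at most 2 *)

(** The scaling makes the twist [u |-> c *: alpha u] of
    [alpha = (f/c, g/c)] a Lie homomorphism with [x |-> f], [y |-> g] and
    [1 |-> c = {f, g}]. *)
Lemma endo_etale f g c :
  c != 0 -> jac f g = c%:MP -> etale c^-1 (endo (c^-1 *: f) (c^-1 *: g)).
Proof.
move=> c0 fg; split; first by rewrite invr_eq0.
rewrite /jac_endo endo_x endo_y jacZl jacZr fg -!mul_mpolyC -!mpolyCM.
by rewrite mulVf // mulr1.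
Qed.

Section Heisenberg.
Variables (M Q : poisson K -> Prop) (psi : poisson K -> poisson K).
Hypotheses (iso : lie_isomorphism M Q psi) (Ml : lin_closed M).
Hypotheses (Maff : forall u, affine u -> M u).

(** A Lie algebra embedding [psi] defined on a space [M] that contains the
    Heisenberg algebra [<1, x, y>] is almost the twist of an etale endomorphism.
    The element [psi 1 = {psi x, psi y}] commutes with [psi x] and [psi y], so
    it is a constant. This defines [alpha], and the twist of [alpha] agrees with
    [psi] on [<1, x, y>]. If it agrees with [psi] on [{u, x}] and [{u, y}],
    then the two values at [u] have the same brackets with [psi x] and [psi y],
    so they differ by a constant. *)
Lemma heisenberg_etale : exists (alpha : {lrmorphism A -> A}) c,
  [/\ etale c alpha,
      forall u, affine u -> psi u = c^-1 *: alpha u &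
      forall u, M u -> M (dx u) -> M (dy u) ->
        psi (dx u) = c^-1 *: alpha (dx u) ->
        psi (dy u) = c^-1 *: alpha (dy u) ->
        exists k, psi u = c^-1 *: alpha u + k%:MP].
Proof.
have [psil psib _ psi_inj _] := iso.
have psiZ a u (Mu : M u) := lie_isomorphismZ iso Ml a Mu.
have psi0 := lie_isomorphism0 iso Ml.
have [M1 Mx My] : [/\ M (1 : A), M xvar & M yvar].
  by split; apply: Maff; [exact: affine1|exact: affine_x|exact: affine_y].
set f : A := psi xvar; set g : A := psi yvar.
have e1 : psi (1 : A) = jac f g.
  by rewrite -[RHS]psib //; congr psi; rewrite /lie /= jac_xl dyy.
have lie1 u : lie (1 : poisson K) u = 0 by rewrite /lie /= /jac !dvarE; ring.
have fg0 : jac f g != 0.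
  rewrite -e1; apply/eqP => p1.
  have := psi_inj _ _ M1 Ml.1 (etrans p1 (esym psi0)).
  by move/eqP; rewrite oner_eq0.
have [c fg] : exists c, jac f g = c%:MP.
  apply: (jac_centralizer fg0).
  - by have := psib _ _ M1 Mx; rewrite lie1 psi0 e1 => /esym.
  - by have := psib _ _ M1 My; rewrite lie1 psi0 e1 => /esym.
have c0 : c != 0 by move: fg0; rewrite fg mpolyC_eq0.
have et := endo_etale c0 fg.
have scl u : c *: (c^-1 *: u) = u :> A by rewrite scalerA mulfV // scale1r.
exists (endo (c^-1 *: f) (c^-1 *: g)), c^-1; rewrite invrK; split => //.
  move=> _ [a [b [e ->]]].
  have aE : a%:MP = a *: 1 :> A by rewrite -mul_mpolyC mulr1.
  have Me : M (e *: yvar : A) by exact: (lin_closedZ _ Ml).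
  rewrite aE -addrA psil //; last exact: Ml.2.
  rewrite psil ?psiZ // ?e1 ?fg //.
  rewrite !linearD !linearZ /= rmorph1 endo_x endo_y.
  rewrite -/f -/g -!mul_mpolyC !mulr1.
  have cc : c%:MP * (c^-1)%:MP = 1 :> A by rewrite -mpolyCM mulfV // mpolyC1.
  by rewrite -[b%:MP * f]mul1r -[e%:MP * g]mul1r -cc; ring.
move=> u Mu Mux Muy ux uy; set alpha := endo _ _ in et ux uy *.
have fE : f = c *: alpha xvar by rewrite endo_x scl.
have gE : g = c *: alpha yvar by rewrite endo_y scl.
have [k uk] : exists k, psi u - c *: alpha u = k%:MP :> A.
  apply: (jac_centralizer fg0); rewrite jacBl.
  - have -> : jac (psi u) f = - (psi (dy u) : A).
      rewrite -[LHS]psib // -scaleN1r -psiZ // scaleN1r.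
      by congr psi; exact: jac_xr.
    rewrite uy fE jacZl jacZr (etale_jac et) jac_xr linearN /= scl scalerN.
    by rewrite addrN.
  - have -> : jac (psi u) g = (psi (dx u) : A).
      by rewrite -[LHS]psib //; congr psi; exact: jac_yr.
    rewrite ux gE jacZl jacZr (etale_jac et) jac_yr scl.
    by rewrite addrN.
by exists k; rewrite -uk addrC subrK.
Qed.
End Heisenberg.

Definition jacobian_conjecture :=
  forall alpha : {lrmorphism A -> A},
    (exists2 c : K, c != 0 & jac_endo alpha = c%:MP) -> bijective alpha.

Lemma lrmorph_inverse (alpha : {lrmorphism A -> A}) :
  bijective alpha ->
  exists alpha' : {lrmorphism A -> A},
    cancel alpha alpha' /\ cancel alpha' alpha.
Proof.
move=> [inv invK Kinv]; exists (endo (inv xvar) (inv yvar)).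
have aK : cancel (endo (inv xvar) (inv yvar)) alpha.
  move=> u; apply: (lrmorph_ext (alpha := alpha \o endo (inv xvar) (inv yvar))
    (beta := idfun)) => /=; by rewrite ?endo_x ?endo_y Kinv.
by split=> // u; apply: (can_inj invK); rewrite aK.
Qed.

Lemma affine_le2 u : affine u -> poisson_le2 u.
Proof.
move=> /affineP[[b ux] [e uy]]; apply/poisson_le2P.
by rewrite ux uy; split; exact: affineC.
Qed.

(** For [u] of degree at most 2 the brackets [{u, x}] and [{u, y}] are
    affine, so [psi u] is the twist of [alpha] at [u] up to a constant, and
    constants belong to [alpha (poisson_le2)]. *)
Lemma poisson_le2_image (Q : poisson K -> Prop) :
  lie_isomorphic (@poisson_le2 K) Q ->
  exists (alpha : {lrmorphism A -> A}) c,
    etale c alpha /\ forall w, Q w <-> exists2 u, poisson_le2 u & w = alpha u.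
Proof.
move=> [psi iso]; have [_ _ psiQ _ psi_surj] := iso.
have Ml : lin_closed (@poisson_le2 K) by exact: lin_closed_span.
have [alpha [c [et psi_aff psi_cst]]] := heisenberg_etale iso Ml affine_le2.
have key u : poisson_le2 u -> exists k, psi u = c^-1 *: alpha u + k%:MP.
  move=> Mu; have [ux uy] := (poisson_le2P u).1 Mu.
  by apply: psi_cst => //; (apply: affine_le2 || apply: psi_aff).
have le2C k : poisson_le2 (k%:MP : A) by apply/affine_le2/affineC.
exists alpha, c; split=> // w; split.
  move=> /psi_surj [u Mu <-]; have [k ->] := key _ Mu.
  exists (c^-1 *: u + k%:MP); first exact: Ml.2.
  by rewrite linearD linearZ /= lrmorphC.
move=> [u Mu ->].
have Mcu : poisson_le2 (c *: u : A) by exact: (lin_closedZ _ Ml).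
have [k e] := key _ Mcu.
(* The twist of the constant [c * k] is [k], the error of [psi] at [c *: u]. *)
have -> : alpha u = psi ((- 1) *: (c * k)%:MP + c *: u : A).
  have [psil _ _ _ _] := iso.
  rewrite [RHS]psil // e psi_aff ?lrmorphC; last exact: affineC.
  have cc : (c^-1)%:MP * c%:MP = 1 :> A.
    by rewrite -mpolyCM mulVf ?et.1 ?mpolyC1.
  rewrite -!mul_mpolyC mpolyCM mpolyCN mpolyC1 rmorphM /= lrmorphC.
  transitivity ((c^-1)%:MP * c%:MP * (alpha u - k%:MP) + k%:MP); last by ring.
  by rewrite cc; ring.
by apply: psiQ; apply: Ml.2 => //.
Qed.

(** Dividing [alpha] by its Jacobian makes it preserve brackets. *)
Lemma le2_image_copy (alpha : {lrmorphism A -> A}) c (Q : poisson K -> Prop) :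
  etale c alpha -> (forall w, Q w <-> exists2 u, poisson_le2 u & w = alpha u) ->
  lie_subalgebra Q /\ lie_isomorphic Q (@poisson_le2 K).
Proof.
move=> et QE; have Ml : lin_closed (@poisson_le2 K) by exact: lin_closed_span.
have [_ _ Mlie] := poisson_le2_subalg.
have Qa u : poisson_le2 u -> Q (alpha u) by move=> Mu; apply/QE; exists u.
have Ql : lin_closed Q.
  split; first by apply/QE; exists 0; [exact: Ml.1|rewrite linear0].
  move=> a _ _ /QE [u Mu ->] /QE [v Mv ->]; apply/QE.
  by exists (a *: u + v); [exact: Ml.2|rewrite linearD linearZ].
split.
  split; [exact: Ql.1|exact: Ql.2|move=> _ _ /QE [u Mu ->] /QE [v Mv ->]].
  apply/QE; exists (c *: lie u v : poisson K); last first.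
    by rewrite [LHS](etale_jac et) linearZ.
  by apply: (lin_closedZ _ Ml); apply: Mlie.
apply: lie_isomorphic_sym => //.
exists (fun u => c^-1 *: alpha u); split.
- move=> a u v _ _; rewrite linearD linearZ /= scalerDr !scalerA.
  by congr (_ *: _ + _); rewrite mulrC.
- move=> u v _ _; symmetry.
  transitivity (jac (c^-1 *: alpha u) (c^-1 *: alpha v)) => //.
  rewrite jacZl jacZr (etale_jac et) [c^-1 *: (c *: _)]scalerA.
  by rewrite mulVf ?et.1 ?scale1r.
- by move=> u Mu; apply: (lin_closedZ _ Ql); apply: Qa.
- move=> u v _ _ /(scalerI _) e; apply: (etale_inj et); apply: e.
  by rewrite invr_eq0 et.1.
- move=> w /QE [u Mu ->]; exists (c *: u); first exact: (lin_closedZ _ Ml).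
  by rewrite linearZ /= scalerA mulVf ?et.1 // scale1r.
Qed.

Definition le2_copies_equivalent :=
  forall Q Q' : poisson K -> Prop,
    lie_subalgebra Q -> lie_subalgebra Q' ->
    lie_isomorphic Q (@poisson_le2 K) -> lie_isomorphic Q' (@poisson_le2 K) ->
    lie_equivalent Q Q'.

(** If [Q] and [Q'] are the images of [alpha] and [beta], two automorphisms
    of the plane with Jacobians [a] and [b], then [beta \o alpha^-1] maps [Q]
    onto [Q'] and multiplies brackets by [b / a]; rescaling it by [a / b]
    makes it a Lie automorphism without changing the image of a subspace. *)
Lemma jc_poisson : jacobian_conjecture -> le2_copies_equivalent.
Proof.
move=> jc Q Q' [Q0 Ql Qlie] [Q'0 Q'l Q'lie] isoQ isoQ'.
have [alpha [a [ea QE]]] :=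
  poisson_le2_image (lie_isomorphic_sym (conj Q0 Ql) Qlie isoQ).
have [beta [b [eb QE']]] :=
  poisson_le2_image (lie_isomorphic_sym (conj Q'0 Q'l) Q'lie isoQ').
have [alpha' [aK Ka]] := lrmorph_inverse (jc alpha (ex_intro2 _ _ a ea.1 ea.2)).
have [beta' [bK Kb]] := lrmorph_inverse (jc beta (ex_intro2 _ _ b eb.1 eb.2)).
have k0 : a / b != 0 by rewrite mulf_neq0 ?invr_eq0 ?ea.1 ?eb.1.
have Ml : lin_closed (@poisson_le2 K) by exact: lin_closed_span.
pose phi : {linear poisson K -> poisson K} :=
  (a / b) \*: (beta \o alpha' : {linear A -> A}).
have phiE u : phi u = (a / b) *: beta (alpha' u) by [].
have phi_alpha u : phi (alpha u) = (a / b) *: beta u by rewrite phiE aK.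
exists phi; split.
  split.
    exists (fun u => (b / a) *: alpha (beta' u)) => u.
    - rewrite phiE [beta' _]linearZ /= [alpha _]linearZ /= bK Ka scalerA.
      by rewrite mulrA divfK ?ea.1 // mulfV ?eb.1 // scale1r.
    - rewrite phiE [alpha' _]linearZ /= [beta _]linearZ /= aK Kb scalerA.
      by rewrite mulrA divfK ?eb.1 // mulfV ?ea.1 // scale1r.
  move=> u v; rewrite -(Ka u) -(Ka v) !phi_alpha.
  have -> : lie (alpha (alpha' u) : poisson K) (alpha (alpha' v))
    = alpha (a *: jac (alpha' u) (alpha' v)).
    by rewrite linearZ; exact: (etale_jac ea).
  rewrite phi_alpha linearZ; symmetry; transitivity
    (jac ((a / b) *: beta (alpha' u)) ((a / b) *: beta (alpha' v))) => //.
  rewrite jacZl jacZr (etale_jac eb) !scalerA /=; congr (_ *: _).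
  by rewrite -!mulrA mulVf ?eb.1 // mulr1.
move=> w; split.
  move=> /QE' [u Mu ->]; exists (alpha ((b / a) *: u)).
    by apply/QE; exists ((b / a) *: u) => //; apply: (lin_closedZ _ Ml).
  rewrite phi_alpha linearZ /= scalerA mulrA divfK ?eb.1 //.
  by rewrite mulfV ?ea.1 // scale1r.
move=> [_ /QE [u Mu ->] <-]; rewrite phi_alpha; apply/QE'.
exists ((a / b) *: u); first exact: (lin_closedZ _ Ml).
by rewrite linearZ.
Qed.

Lemma dx_monomial i j :
  dx (xvar ^+ i * yvar ^+ j) = i%:R *: (xvar ^+ i.-1 * yvar ^+ j) :> A.
Proof.
have dX n : dx (xvar ^+ n) = n%:R *: xvar ^+ n.-1 :> A.
  elim: n => [|n IHn]; first by rewrite expr0 dx1 scale0r.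
  rewrite exprS dxM IHn dxx mul1r -scalerAr -natr1 scalerDl scale1r addrC.
  by case: n {IHn} => [|n]; rewrite ?scale0r // -exprS.
have dY n : dx (yvar ^+ n) = 0 :> A.
  elim: n => [|n IHn]; first by rewrite expr0 dx1.
  by rewrite exprS dxM IHn dxy mul0r mulr0 addr0.
by rewrite dxM dX dY mulr0 addr0 scalerAl.
Qed.

Lemma dy_monomial i j :
  dy (xvar ^+ i * yvar ^+ j) = j%:R *: (xvar ^+ i * yvar ^+ j.-1) :> A.
Proof.
have dY n : dy (yvar ^+ n) = n%:R *: yvar ^+ n.-1 :> A.
  elim: n => [|n IHn]; first by rewrite expr0 dy1 scale0r.
  rewrite exprS dyM IHn dyy mul1r -scalerAr -natr1 scalerDl scale1r addrC.
  by case: n {IHn} => [|n]; rewrite ?scale0r // -exprS.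
have dX n : dy (xvar ^+ n) = 0 :> A.
  elim: n => [|n IHn]; first by rewrite expr0 dy1.
  by rewrite exprS dyM IHn dyx mul0r mulr0 addr0.
by rewrite dyM dX dY mul0r add0r scalerAr.
Qed.

(** In degree [d >= 2] every monomial is a multiple of a bracket of
    polynomials of degree at most [d]: of [{x^2, x^(i-1) y^(j+1)}], or of
    [{x y, y^j}] when [i = 0]. So the property propagates from degree to degree
    although the bracket hypothesis only controls the gradients of its
    arguments. *)
Lemma poisson_generation (P : A -> Prop) :
  @lin_closed K A P -> P 1 -> P xvar -> P yvar ->
  (forall u v, P (dx u) -> P (dy u) -> P (dx v) -> P (dy v) -> P (jac u v)) ->
  forall u, P u.
Proof.
move=> Pl P1 Px Py Pj.
apply: monomial_ind; [exact: Pl.2|exact: Pl.1|move=> i j].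
have [n] := ubnP (i + j); elim: n i j => // n IHn i j; rewrite ltnS => ijn.
have PZ a u : P u -> P (a *: u) by exact: (lin_closedZ _ Pl).
have P0 := Pl.1.
case: i => [|i] in ijn *; last first.
  have -> : xvar ^+ i.+1 * yvar ^+ j
    = (2%:R^-1 / j.+1%:R) *: jac (xvar ^+ 2) (xvar ^+ i * yvar ^+ j.+1) :> A.
    have := dx_monomial 2 0; rewrite /jac expr0 !mulr1 /= => ->.
    have := dy_monomial 2 0; rewrite expr0 !mulr1 /= scale0r => ->.
    rewrite mul0r subr0 dy_monomial /= expr1 -scalerAl -scalerAr !scalerA.
    rewrite mulrA -exprS mulrAC divfK ?natr_neq0 // mulVf ?natr_neq0 //.
    by rewrite scale1r.
  apply/PZ/Pj.
  - have := dx_monomial 2 0; rewrite expr0 !mulr1 /= => ->; exact: PZ.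
  - by have := dy_monomial 2 0; rewrite expr0 !mulr1 /= scale0r => ->.
  - rewrite dx_monomial; case: i => [|i] in ijn *; first by rewrite scale0r.
    by apply/PZ/IHn; rewrite addnS -addSn.
  - by rewrite dy_monomial; apply/PZ/IHn.
case: j => [|j] in ijn *; first by rewrite !expr0 mulr1.
rewrite mul1r.
have dxyj m : dx (yvar ^+ m) = 0 :> A.
  by have := dx_monomial 0 m; rewrite mul1r scale0r.
have dyyj m : dy (yvar ^+ m) = m%:R *: yvar ^+ m.-1 :> A.
  by have := dy_monomial 0 m; rewrite !mul1r.
have -> : yvar ^+ j.+1 = j.+1%:R^-1 *: jac (xvar * yvar) (yvar ^+ j.+1) :> A.
  rewrite /jac dxyj dyyj dxM !dvarE mulr0 mul1r addr0 mulr0 subr0 -scalerAr.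
  by rewrite scalerA mulVf ?natr_neq0 // scale1r -exprS.
apply/PZ/Pj.
- by rewrite dxM !dvarE mulr0 mul1r addr0.
- by rewrite dyM !dvarE mulr1 mul0r add0r.
- by rewrite dxyj.
- by rewrite dyyj; apply: PZ; have := IHn 0%N j; rewrite mul1r; apply.
Qed.

(** By [heisenberg_etale] the automorphism and the twist of [beta] differ by
    a constant at every [u] whose partial derivatives satisfy the claim.
    Constants disappear in brackets, so the claim holds for brackets of such
    polynomials, and [poisson_generation] applies. *)
Lemma poisson_automorphism_etale (phi : {linear poisson K -> poisson K}) :
  lie_automorphism phi ->
  exists (beta : {lrmorphism A -> A}) c,
    c != 0 /\ forall u, phi u = c^-1 *: beta u.
Proof.
move=> [phi_bij phi_lie].
have iso : lie_isomorphism (fun=> True) (fun=> True) phi.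
  split=> //.
  - by move=> a u v _ _; rewrite linearD linearZ.
  - by move=> u v _ _; apply: (bij_inj phi_bij).
  - by move=> w _; have [inv _ invK] := phi_bij; exists (inv w).
have Tl : @lin_closed K (poisson K) (fun=> True) by [].
have [beta [c [et phi_aff phi_cst]]] := heisenberg_etale iso Tl (fun _ _ => I).
exists beta, c; split; first exact: et.1.
apply: poisson_generation.
- split; first by rewrite linear0 (linear0 beta) scaler0.
  move=> a u v eu ev; rewrite [LHS]linearD [phi (a *: u)]linearZ /= eu ev.
  have -> : beta (a *: u + v) = a *: beta u + beta v by rewrite linearD linearZ.
  by rewrite -!mul_mpolyC; ring.
- by apply/phi_aff/affine1.
- by apply/phi_aff/affine_x.
- by apply/phi_aff/affine_y.
move=> u v ux uy vx vy.
have [k uk] := phi_cst u I I I ux uy.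
have [l vl] := phi_cst v I I I vx vy.
transitivity (jac (phi u) (phi v)); first exact: phi_lie.
have jC w r s m : jac (r + s%:MP) (w + m%:MP) = jac r w.
  by rewrite /jac !dxD !dyD !dvarE !addr0.
rewrite uk vl jC jacZl jacZr (etale_jac et).
by rewrite [c^-1 *: (c *: _)]scalerA mulVf ?et.1 ?scale1r.
Qed.

Lemma etale_surj_bij (alpha : {lrmorphism A -> A}) c :
  etale c alpha -> (forall w, exists u, alpha u = w) -> bijective alpha.
Proof.
move=> et surj.
have surjb w : exists u, alpha u == w by have [u <-] := surj w; exists u.
exists (fun w => xchoose (surjb w)) => u; last exact/eqP/(xchooseP (surjb u)).
by apply: (etale_inj et); apply/eqP/(xchooseP (surjb (alpha u))).
Qed.

(** Let [alpha] be etale and [phi] a Lie automorphism that maps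
    [poisson_le2] onto its image under [alpha]. As [phi] is a multiple of an
    endomorphism [beta] with [beta x] and [beta y] in the subalgebra
    [alpha K[x, y]], that subalgebra contains the image of [phi], which is
    everything. *)
Lemma poisson_jc : le2_copies_equivalent -> jacobian_conjecture.
Proof.
move=> equiv alpha [c c0 jc]; have et : etale c alpha by [].
apply: (etale_surj_bij et).
have [subQ isoQ] :=
  le2_image_copy (Q := fun w => exists2 u, poisson_le2 u & w = alpha u)
    et (fun=> iff_refl _).
have isoP : lie_isomorphic (@poisson_le2 K) (@poisson_le2 K).
  by exists id; split=> //; move=> w Mw; exists w.
have [phi [phi_aut phiQ]] := equiv _ _ poisson_le2_subalg subQ isoP isoQ.
have [beta [b [b0 phiE]]] := poisson_automorphism_etale phi_aut.
have im_gen u : affine u -> exists v, alpha v = beta u.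
  move=> /affine_le2 Mu; have [v _ e] := (phiQ _).2 (ex_intro2 _ _ u Mu erefl).
  exists (b *: v); rewrite linearZ /= -e phiE scalerA mulfV //.
  exact: scale1r.
have im_beta : forall u, exists v, alpha v = beta u.
  apply: subalgebra_full.
  - move=> a u v [u' eu] [v' ev]; exists (a *: u' + v').
    by rewrite !linearD !linearZ /= eu ev.
  - by move=> u v [u' eu] [v' ev]; exists (u' * v'); rewrite !rmorphM /= eu ev.
  - exact/im_gen/affine1.
  - exact/im_gen/affine_x.
  - exact/im_gen/affine_y.
move=> w; have [inv _ Kinv] := phi_aut.1.
have [v ev] := im_beta (inv w); exists (b^-1 *: v).
by rewrite linearZ /= ev -phiE Kinv.
Qed.

(** * Copies of saff2 and aff2 in the fields of constant divergence *)

Lemma constant_factor p q a :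
  p * q = a%:MP -> (exists b, p = b%:MP) \/ (exists b, q = b%:MP).
Proof.
have [-> _|p0] := eqVneq p 0; first by left; exists 0; rewrite mpolyC0.
have [-> _|q0] := eqVneq q 0; first by right; exists 0; rewrite mpolyC0.
move=> pq; left; exists p@_0; apply: msize1_polyC.
have := msizeM p0 q0; rewrite pq msizeC.
have : (0 < msize p)%N by rewrite lt0n msize_poly_eq0.
have : (0 < msize q)%N by rewrite lt0n msize_poly_eq0.
case: (msize p) (msize q) => [|[|n]] // [|m] //.
by rewrite addSn addnS /= => _ _; case: eqP.
Qed.

(** If [f] and [g] are algebraically dependent and [h] acts on them
    with weights [1] and [-1] up to constants, then [(f + a)(g - b)] has weight
    [0]: its gradient is [{f, g}] times minus that of [h], hence zero. A
    product of two polynomials is constant only if one of them is. *)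
Lemma jac_hyperbolic f g h a b :
  jac f g = 0 -> jac h f = f + a%:MP -> jac h g = b%:MP - g ->
  (exists k, f = k%:MP) \/ (exists k, g = k%:MP).
Proof.
move=> fg0 hf hg.
have [e fge] : exists e, (f + a%:MP) * (g - b%:MP) = e%:MP.
  apply: constant_dxdy;
  rewrite ?dxM ?dyM ?dxB ?dyB ?dxD ?dyD !dvarE !(addr0, subr0);
  rewrite -hf -[g - _]opprB -hg.
  - transitivity (- dx h * jac f g); first by rewrite /jac; ring.
    by rewrite fg0 mulr0.
  - transitivity (- dy h * jac f g); first by rewrite /jac; ring.
    by rewrite fg0 mulr0.
have [[k fk]|[k gk]] := constant_factor fge; [left|right].
- by exists (k - a); rewrite mpolyCB -fk addrK.
- by exists (k + b); rewrite mpolyCD -gk subrK.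
Qed.

(** [saff2] and [aff2] are treated at once, as instances of a
    Lie algebra [M] between them. *)
Section Model.
Variable M : vecfield K -> Prop.
Hypothesis Ml : lin_closed M.
Hypothesis saffM : forall D, saff2 D -> M D.
Hypothesis Maff : forall D, M D -> aff2 D.

Lemma model_field p q :
  affine p -> affine q -> dx p + dy q = 0 -> M (p, q).
Proof. by move=> Ap Aq dpq; apply/saffM/saff2P; split=> //; apply/aff2P. Qed.

Lemma model_constant a b : M (a%:MP, b%:MP).
Proof. by apply: model_field; rewrite ?dvarE ?addr0. Qed.

Lemma model_lie_constant D a b : M D ->
  exists a' b', lie D (a%:MP, b%:MP) = (a'%:MP, b'%:MP).
Proof.
move=> /Maff/aff2P [/affineP[[r Dr] [s Ds]] /affineP[[r' Dr'] [s' Ds']]].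
exists (- (a * r + b * s)), (- (a * r' + b * s')).
congr pair; rewrite vf_appC sub0r /vf_app /= ?Dr ?Ds ?Dr' ?Ds';
by rewrite mpolyCN mpolyCD !mpolyCM.
Qed.

Section Image.
Variables (L : vecfield K -> Prop) (psi : vecfield K -> vecfield K).
Hypotheses (Ldiv : forall D, L D -> vec_c D) (iso : lie_isomorphism M L psi).

(** Fields of constant divergence have divergence-free brackets, and
    [d/dx], [d/dy] and [x d/dx - y d/dy] are all brackets in
    [saff2]. So their images have Hamiltonians [- g], [f] and [h], and the
    relations among them say that [{f, g}] is a constant and that [h] acts
    on [f] and [g] as required by [jac_hyperbolic]. *)
Lemma model_potentials : exists f g c,
  [/\ c != 0, jac f g = c%:MP, psi (0, 1) = ham f & psi (1, 0) = ham (- g)].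
Proof.
have [_ psib psiL psi_inj _] := iso.
have psi0 := lie_isomorphism0 iso Ml.
have div0 D E : M D -> M E -> divergence (psi (lie D E)) = 0.
  move=> /[dup] MD /psiL/Ldiv [a da] /[dup] ME /psiL/Ldiv [b db].
  by rewrite psib // divergence_lie da db !vf_appC subrr.
pose X : vecfield K := (0, 1); pose Y : vecfield K := (1, 0).
pose H : vecfield K := (xvar, - yvar).
have MX : M X by apply: model_field; rewrite ?dvarE ?addr0.
have MY : M Y by apply: model_field; rewrite ?dvarE ?addr0.
have MH : M H.
  by apply: model_field; rewrite ?dyN ?dvarE ?subrr //; exact: affineN.
have Mxdy : M (0, xvar) by apply: model_field; rewrite ?dvarE ?addr0.
have Mydx : M (yvar, 0) by apply: model_field; rewrite ?dvarE ?addr0.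
have HE : H = lie ((0, xvar) : vecfield K) (yvar, 0).
  by rewrite /lie /= /vf_lie /vf_app /= !dvarE; congr pair; ring.
have XE : X = lie H X.
  by rewrite /lie /= /vf_lie /vf_app /= !dyN !dxN !dvarE; congr pair; ring.
have YE : Y = lie Y H.
  rewrite /lie /= /vf_lie /vf_app /= !dyN !dxN !dvarE.
  by congr pair; rewrite /=; ring.
have XY0 : 0 = lie X Y.
  by rewrite /lie /= /vf_lie /vf_app /= !dvarE; congr pair; ring.
have [h hE] : exists h, psi H = ham h.
  by apply: divergence0_ham; rewrite HE; apply: div0.
have [f fE] : exists f, psi X = ham f.
  by apply: divergence0_ham; rewrite XE; apply: div0.
have [g gE] : exists g, psi Y = ham (- g).
  have [|g gE] := @divergence0_ham (psi Y); first by rewrite YE; apply: div0.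
  by exists (- g); rewrite opprK.
have nonconstant D u :
    M D -> D <> 0 -> psi D = ham u -> forall a, u <> a%:MP.
  move=> MD D0 e a ua; apply/D0/psi_inj => //; first exact: Ml.1.
  by rewrite psi0 e ua /ham !dvarE oppr0.
have f_nonconst : forall a, f <> a%:MP.
  by apply: nonconstant fE => // /(congr1 snd) /eqP; rewrite oner_eq0.
have g_nonconst a : g <> a%:MP.
  move=> ga; have Ng : - g = (- a)%:MP by rewrite ga mpolyCN.
  apply: nonconstant gE _ Ng => // /(congr1 fst) /eqP.
  by rewrite oner_eq0.
have [c fg] : exists c, jac f g = c%:MP.
  have [|c fg] := @ham_eq0 (jac f (- g)).
    by rewrite -lie_ham -fE -gE -psib // -XY0 psi0.
  by exists (- c); rewrite mpolyCN -fg /jac !dE; ring.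
exists f, g, c; split=> //; apply/eqP => c0.
have [a ha] : exists a, jac h f - f = a%:MP.
  by apply: ham_eq0; rewrite hamB -lie_ham -hE -fE -psib // -XE subrr.
have [b hb] : exists b, jac (- g) h - (- g) = b%:MP.
  by apply: ham_eq0; rewrite hamB -lie_ham -hE -gE -psib // -YE subrr.
have fg0 : jac f g = 0 by rewrite fg c0 mpolyC0.
have jhf : jac h f = f + a%:MP by rewrite -ha addrC subrK.
have jhg : jac h g = b%:MP - g by rewrite -hb /jac !dE; ring.
have [[k fk]|[k gk]] := jac_hyperbolic fg0 jhf jhg.
- exact: (f_nonconst k).
- exact: (g_nonconst k).
Qed.

(** With [alpha = (f/c, g/c)], [psi] and the push-forward along [alpha]
    agree on constant fields. For [D] in [M] the brackets of [D] with the
    constant fields are constant, so [psi D - push D] centralises the pushed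
    constant fields and is itself one of them: [psi D] is the push-forward of
    a field of [M] that differs from [D] by a constant field. *)
Lemma model_image_iso : exists (alpha : {lrmorphism A -> A}) c,
  etale c alpha /\ forall E, L E <-> exists2 D, M D & E = push alpha c D.
Proof.
have [psil psib psiL _ psi_surj] := iso.
have psiZ a D (MD : M D) := lie_isomorphismZ iso Ml a MD.
have [f [g [c [c0 fg psiX psiY]]]] := model_potentials.
have et := endo_etale c0 fg.
set alpha := endo _ _ in et.
have scl u : c *: (c^-1 *: u) = u :> A by rewrite scalerA mulfV // scale1r.
exists alpha, c^-1; split=> //.
have pushX : push alpha c^-1 (0, 1) = psi (0, 1).
  by rewrite psiX -ham_x (push_ham et) endo_x -hamZ invrK scl.
have pushY : push alpha c^-1 (1, 0) = psi (1, 0).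
  rewrite psiY -ham_y (push_ham et) (linearN alpha) /= endo_y -hamZ invrK.
  by rewrite scalerN scl.
have push_cst a b : push alpha c^-1 (a%:MP, b%:MP) = psi (a%:MP, b%:MP).
  have -> : (a%:MP, b%:MP) = a *: (1, 0) + b *: (0, 1) :> vecfield K.
    by congr pair; rewrite /= -!mul_mpolyC; ring.
  have [M1 M2] : M (1, 0) /\ M (0, 1).
    by split; rewrite -mpolyC1 -mpolyC0; exact: model_constant.
  rewrite (push_lin et) (pushZ et) pushX pushY psil ?psiZ //.
  exact: (lin_closedZ _ Ml).
have psi_push D : M D ->
    exists a b, psi D = push alpha c^-1 (D + (a%:MP, b%:MP)).
  move=> MD; have commutes a b :
      lie (psi D - push alpha c^-1 D) (push alpha c^-1 (a%:MP, b%:MP)) = 0.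
    rewrite addrC -scaleN1r lie_linearl -(push_lie et) push_cst -psib //.
      have [a' [b' ->]] := model_lie_constant a b MD.
      by rewrite push_cst scaleN1r addNr.
    exact: model_constant.
  have [||a [b e]] := push_centralizer et (N := psi D - push alpha c^-1 D).
  - by have := commutes 1 0; rewrite mpolyC1 mpolyC0.
  - by have := commutes 0 1; rewrite mpolyC1 mpolyC0.
  by exists a, b; rewrite (pushD et) -e addrC subrK.
move=> E; split.
  move=> /psi_surj [D MD <-]; have [a [b e]] := psi_push D MD.
  exists (D + (a%:MP, b%:MP)) => //.
  by apply: (lin_closedD Ml) => //; exact: model_constant.
move=> [D MD ->]; have [a [b e]] := psi_push D MD.
have -> : push alpha c^-1 D = psi ((-1) *: (a%:MP, b%:MP) + D).
  rewrite psil //; last exact: model_constant.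
  by rewrite -push_cst e (pushD et) scaleN1r addrC addrK.
by apply: psiL; apply: Ml.2 => //; exact: model_constant.
Qed.

End Image.

Lemma model_image (L : vecfield K -> Prop) :
  (forall D, L D -> vec_c D) -> lie_isomorphic M L ->
  exists (alpha : {lrmorphism A -> A}) c,
    etale c alpha /\ forall E, L E <-> exists2 D, M D & E = push alpha c D.
Proof. by move=> Ldiv [psi iso]; exact: model_image_iso Ldiv iso. Qed.

Hypothesis Mlie : forall D E, M D -> M E -> M (lie D E).

Lemma push_model (alpha : {lrmorphism A -> A}) c (L : vecfield K -> Prop) :
  etale c alpha -> (forall E, L E <-> exists2 D, M D & E = push alpha c D) ->
  [/\ lie_subalgebra L, forall E, L E -> vec_c E & lie_isomorphic L M].
Proof.
move=> et LE.
have Lp D : M D -> L (push alpha c D) by move=> MD; apply/LE; exists D.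
have Ll : lin_closed L.
  split.
    have -> : 0 = push alpha c 0.
      by rewrite -[0 in RHS](scale0r 0) (pushZ et) scale0r.
    exact/Lp/Ml.1.
  move=> a _ _ /LE [D MD ->] /LE [E ME ->].
  by rewrite -(push_lin et); apply/Lp/Ml.2.
have Llie D E : L D -> L E -> L (lie D E).
  move=> /LE [D' MD ->] /LE [E' ME ->].
  by rewrite -(push_lie et); apply/Lp/Mlie.
split.
- by split; [exact: Ll.1|exact: Ll.2|exact: Llie].
- move=> _ /LE [D /Maff/aff2_vec_c [a Da] ->].
  by exists a; rewrite (divergence_push et) Da lrmorphC.
apply: lie_isomorphic_sym => //; exists (push alpha c); split=> //.
- by move=> a D E _ _; exact: (push_lin et).
- by move=> D E _ _; exact: (push_lie et).
- by move=> D E _ _; exact: (push_inj et).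
- by move=> E /LE [D MD ->]; exists D.
Qed.

Definition copies_conjugate :=
  forall L L' : vecfield K -> Prop,
    lie_subalgebra L -> (forall D, L D -> vec_c D) ->
    lie_subalgebra L' -> (forall D, L' D -> vec_c D) ->
    lie_isomorphic L M -> lie_isomorphic L' M -> conjugate L L'.

(** Two copies are the push-forwards of [M] along some [alpha] and [beta].
    When these are automorphisms, [beta \o alpha^-1] conjugates one copy into
    the other. *)
Lemma jc_model : jacobian_conjecture -> copies_conjugate.
Proof.
move=> jc L L' [L0 Ll Llie] Ldiv [L'0 L'l L'lie] L'div isoL isoL'.
have [alpha [a [ea LE]]] :=
  model_image Ldiv (lie_isomorphic_sym (conj L0 Ll) Llie isoL).
have [beta [b [eb LE']]] :=
  model_image L'div (lie_isomorphic_sym (conj L'0 L'l) L'lie isoL').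
have [alpha' [aK Ka]] := lrmorph_inverse (jc alpha (ex_intro2 _ _ a ea.1 ea.2)).
have [beta' [bK Kb]] := lrmorph_inverse (jc beta (ex_intro2 _ _ b eb.1 eb.2)).
exists (beta \o alpha' : {lrmorphism A -> A}), (alpha \o beta'); split.
- by move=> u /=; rewrite bK Ka.
- by move=> u /=; rewrite aK Kb.
have app D u : vf_app (push beta b D) u
    = beta (alpha' (vf_app (push alpha a D) (alpha (beta' u)))).
  by rewrite (push_app ea) aK -(push_app eb) Kb.
move=> E; split.
  move=> /LE' [D MD ->]; exists (push alpha a D); first by apply/LE; exists D.
  by move=> u; exact: app.
move=> [_ /LE [D MD ->] e]; apply/LE'; exists D => //.
by apply: (push_ext eb) => u; rewrite e app.
Qed.

(** Differentiating a nonconstant element of [V] as long as the result is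
    not constant leads to [a x + b y + e] with [a] and [b] not both zero; then
    [y d/dx] and [x d/dy] produce [y] and [x]. *)
Lemma saff2_module_vars (V : A -> Prop) w :
  @lin_closed K A V ->
  (forall D u, saff2 D -> V u -> V (vf_app D u)) ->
  V w -> (forall a, w <> a%:MP) -> V xvar /\ V yvar.
Proof.
move=> Vl VD.
have fld p q u : affine p -> affine q -> dx p + dy q = 0 -> V u ->
    V (p * dx u + q * dy u).
  move=> Ap Aq dpq; apply: VD (p, q) u _; apply/saff2P.
  by split=> //; apply/aff2P.
have Vdx u : V u -> V (dx u).
  move=> /(fld 1 0); rewrite mul1r mul0r addr0 !dvarE addr0.
  by apply.
have Vdy u : V u -> V (dy u).
  move=> /(fld 0 1); rewrite mul1r mul0r add0r !dvarE addr0.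
  by apply.
have Vydx u : V u -> V (yvar * dx u).
  move=> /(fld yvar 0); rewrite mul0r addr0 !dvarE addr0.
  by apply.
have Vxdy u : V u -> V (xvar * dy u).
  move=> /(fld 0 xvar); rewrite mul0r add0r !dvarE addr0.
  by apply.
elim/derivative_ind: w => [a _ /(_ a)|w IHx IHy Vw w_ncst] //.
have [[a wx]|wx] := classic (exists a, dx w = a%:MP); last first.
  by apply: IHx (Vdx _ Vw) _ => a wa; apply: wx; exists a.
have [[b wy]|wy] := classic (exists b, dy w = b%:MP); last first.
  by apply: IHy (Vdy _ Vw) _ => b wb; apply: wy; exists b.
have Vy : a != 0 -> V yvar.
  move=> a0; have := lin_closedZ a^-1 Vl (Vydx _ Vw).
  by rewrite wx mulrC mul_mpolyC scalerA mulVf // scale1r.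
have Vx : b != 0 -> V xvar.
  move=> b0; have := lin_closedZ b^-1 Vl (Vxdy _ Vw).
  by rewrite wy mulrC mul_mpolyC scalerA mulVf // scale1r.
have [a0|a0] := eqVneq a 0; last first.
  by split; [have := Vxdy _ (Vy a0); rewrite dyy mulr1|exact: Vy].
have [b0|b0] := eqVneq b 0; last first.
  by split; [exact: Vx|have := Vydx _ (Vx b0); rewrite dxx mulr1].
have [||e we] := constant_dxdy (u := w); first by rewrite wx a0 mpolyC0.
  by rewrite wy b0 mpolyC0.
by case: (w_ncst e).
Qed.

(** For an etale [alpha], let [beta] conjugate the push-forward of [M] into
    [M]. The subalgebra [beta (alpha K[x, y])] is stable under [M], hence under
    [saff2], and it is not reduced to the constants since [alpha] is injective.
    By [saff2_module_vars] it contains [x] and [y]; so [alpha] is surjective. *)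
Lemma model_jc : copies_conjugate -> jacobian_conjecture.
Proof.
move=> conj alpha [c c0 jc]; have et : etale c alpha by [].
apply: (etale_surj_bij et).
have [subL divL isoL] :=
  push_model (L := fun E => exists2 D, M D & E = push alpha c D)
    et (fun=> iff_refl _).
have isoM : lie_isomorphic M M by exists id; split=> //; move=> w Mw; exists w.
have subM : lie_subalgebra M by split; [exact: Ml.1|exact: Ml.2|exact: Mlie].
have divM D : M D -> vec_c D by move=> /Maff; exact: aff2_vec_c.
have [beta [beta' [bK Kb conjE]]] := conj _ _ subL divL subM divM isoL isoM.
pose V w := exists u, beta (alpha u) = w.
have Vl : @lin_closed K A V.
  split; first by exists 0; rewrite !linear0.
  by move=> a _ _ [u <-] [v <-]; exists (a *: u + v); rewrite !linearD !linearZ.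
have VD D u : saff2 D -> V u -> V (vf_app D u).
  move=> /saffM/conjE [_ [D0 MD0 ->] e] [v <-]; exists (vf_app D0 v).
  by rewrite e /= bK (push_app et).
have ncst a : beta (alpha xvar) <> a%:MP.
  rewrite -(lrmorphC beta) -(lrmorphC alpha) => /(can_inj bK)/(etale_inj et) xa.
  have := congr1 (@dx K) xa; rewrite dxx dxC => /eqP.
  by rewrite oner_eq0.
have [Vx Vy] := saff2_module_vars Vl VD (ex_intro _ xvar erefl) ncst.
have Vall : forall w, V w.
  apply: subalgebra_full => //; first exact: Vl.2.
    by move=> _ _ [u <-] [v <-]; exists (u * v); rewrite !rmorphM.
  by exists 1; rewrite !rmorph1.
by move=> w; have [u e] := Vall (beta w); exists u; exact: (can_inj bK).
Qed.

End Model.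

Lemma saff2_aff2 D : saff2 D -> aff2 D.
Proof. by move=> /saff2P []. Qed.

End Plane.

(** * Equivalence with the Jacobian Conjecture *)

Unset Implicit Arguments.
Theorem theorem4p1 (K : closedFieldType) (charK0 : [pchar K] =i pred0) :
  [<->
    (forall alpha : {lrmorphism {mpoly K[2]} -> {mpoly K[2]}},
       (exists2 c : K, c != 0 & jac_endo alpha = c%:MP) -> bijective alpha);
    (forall Q Q' : poisson K -> Prop,
       lie_subalgebra Q -> lie_subalgebra Q' ->
       lie_isomorphic Q (@poisson_le2 K) -> lie_isomorphic Q' (@poisson_le2 K) ->
       lie_equivalent Q Q');
    (forall L L' : vecfield K -> Prop,
       lie_subalgebra L -> (forall D, L D -> vec_c D) ->
       lie_subalgebra L' -> (forall D, L' D -> vec_c D) ->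
       lie_isomorphic L (@saff2 K) -> lie_isomorphic L' (@saff2 K) ->
       conjugate L L');
    (forall L L' : vecfield K -> Prop,
       lie_subalgebra L -> (forall D, L D -> vec_c D) ->
       lie_subalgebra L' -> (forall D, L' D -> vec_c D) ->
       lie_isomorphic L (@aff2 K) -> lie_isomorphic L' (@aff2 K) ->
       conjugate L L')].
Proof.
have saff_sub := @saff2_aff2 K charK0.
have [s0 sl slie] := saff2_subalg charK0.
have [a0 al alie] := aff2_subalg charK0.
tfae.
- exact: (jc_poisson charK0).
- by move=> /(poisson_jc charK0); apply: (jc_model charK0 (conj s0 sl)).
- move=> /(model_jc charK0 (conj s0 sl) (fun D => id) saff_sub slie).
  exact: (jc_model charK0 (conj a0 al)).
- exact: (model_jc charK0 (conj a0 al) saff_sub (fun D => id) alie).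
Qed.
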